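(* Let $k$ be a positive integer and let $\mu,\lambda$ be integer partitions of $k$, both different from $1^k=(1,1,\dots,1)$. For a partition $\nu\neq 1^k$ of $k$, let $\varsigma_\nu$ denote the smallest part of $\nu$ not equal to $1$. Then $\mu\preceq\lambda$ if and only if $\mu$ is coarser than $\lambda$ (in refinement order on integer partitions) and $\varsigma_\mu\geqslant\varsigma_\lambda$.
   Context: A set partition of a finite set $X$ is a set of nonempty pairwise disjoint subsets (blocks) of $X$ whose union is $X$; its type is the integer partition obtained by sorting the block sizes in weakly decreasing order. For set partitions of $[k]=\{1,\dots,k\}$, $\pi\vee\tau$ denotes their join in the refinement order (the finest set partition coarser than both). For integer partitions $\mu,\lambda$ of $k$, define $\mu \preceq \lambda$ if there exist an integer $\ell\ge0$ and set partitions $\pi_0,\dots,\pi_\ell$ of $[k]$, each of type $\lambda$, such that $\pi_0\vee\cdots\vee\pi_\ell$ has type $\mu$. An integer partition $\mu$ is coarser than $\lambda=(\lambda_1,\dots,\lambda_r)$ if there is a set partition $\{I_1,\dots,I_d\}$ of $[r]$ such that $\mu$ is the weakly decreasing rearrangement of $(\sum_{i\in I_1}\lambda_i,\dots,\sum_{i\in I_d}\lambda_i)$. *)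

(* Defs.v *)
From HB Require Import structures.
From mathcomp Require Import all_boot all_order.

Set Implicit Arguments.
Unset Strict Implicit.
Unset Printing Implicit Defensive.

Import Order.TTheory.

Record setpart (T : finType) : Type := SetPart {
  blocks : {set {set T}};
  blocksP : partition blocks [set: T]
}.

HB.instance Definition _ (T : finType) := [isSub for @blocks T].
HB.instance Definition _ (T : finType) := [Finite of setpart T by <:].

(* Orientation: p <= q when p is finer than q, so the order-theoretic join of
   set partitions is the finest set partition coarser than all of them. *)

Section Refinement.
Variable T : finType.
Implicit Types (p q r : setpart T) (x y z : T) (B C : {set T}).

Definition refines p q : bool :=
  [forall B in blocks p, exists C in blocks q, B \subset C].

Definition same_block p : rel T := fun x y => y \in pblock (blocks p) x.

Lemma setpart_tiP p : trivIset (blocks p).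
Proof. exact: partition_trivIset (blocksP p). Qed.

Lemma setpart_cover p x : x \in cover (blocks p).
Proof. by rewrite (cover_partition (blocksP p)) inE. Qed.

Lemma same_block_equiv p : equivalence_rel (same_block p).
Proof. by move=> x y z; apply: (pblock_equivalence (blocksP p)); rewrite inE. Qed.

Lemma same_block_refl p : reflexive (same_block p).
Proof. by move=> x; rewrite /same_block mem_pblock setpart_cover. Qed.

Lemma same_block_inj p q : same_block p =2 same_block q -> p = q.
Proof.
move=> epq; apply: val_inj; rewrite /=.
rewrite -(equivalence_partition_pblock (blocksP p)).
rewrite -(equivalence_partition_pblock (blocksP q)).
apply: eq_imset => x; apply/setP=> y; rewrite !inE.
exact: epq.
Qed.

Lemma refinesP p q :
  reflect (forall x y, same_block p x y -> same_block q x y) (refines p q).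
Proof.
apply: (iffP forall_inP) => [pq x y xy | pq B pB].
  have /exists_inP[C qC /subsetP sBC] := pq _ (pblock_mem (setpart_cover p x)).
  rewrite /same_block (def_pblock (setpart_tiP q) qC); first exact: sBC.
  by apply: sBC; rewrite mem_pblock setpart_cover.
have /set0Pn[x Bx] := partition_neq0 (blocksP p) pB.
apply/exists_inP; exists (pblock (blocks q) x).
  by rewrite pblock_mem ?setpart_cover.
apply/subsetP=> y By; apply: pq.
by rewrite /same_block (def_pblock (setpart_tiP p) pB Bx).
Qed.

Lemma refines_refl : reflexive refines.
Proof. by move=> p; apply/refinesP. Qed.

Lemma refines_anti : antisymmetric refines.
Proof.
move=> p q /andP[/refinesP pq /refinesP qp]; apply: same_block_inj => x y.
by apply/idP/idP; [apply: pq | apply: qp].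
Qed.

Lemma refines_trans : transitive refines.
Proof.
move=> q p r /refinesP pq /refinesP qr; apply/refinesP=> x y xy.
exact: qr (pq _ _ xy).
Qed.

Definition setpart_of (e : rel T) (eP : equivalence_rel e) : setpart T :=
  SetPart (equivalence_partitionP (in3W eP : {in [set: T] & &, _})).

Lemma same_block_of e (eP : equivalence_rel e) :
  same_block (setpart_of eP) =2 e.
Proof.
move=> x y; rewrite /same_block.
by apply: (pblock_equivalence_partition (in3W eP)); rewrite inE.
Qed.

Definition linked p q : rel T := fun x y => same_block p x y || same_block q x y.

Lemma linked_equiv p q : equivalence_rel (connect (linked p q)).
Proof.
have symb r : symmetric (same_block r).
  by have /equivalence_relP[r1 rs] := same_block_equiv r => x y;
     apply/idP/idP => /rs; move=> <-; apply: r1.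
have syml : connect_sym (linked p q).
  by apply: sym_connect_sym => x y; rewrite /linked !(symb _ x).
apply/equivalence_relP; split; first exact: connect0.
by move=> x y xy; apply: same_connect.
Qed.

Definition setpart_join p q : setpart T := setpart_of (linked_equiv p q).

Lemma refines_joinl p q r :
  refines (setpart_join p q) r = refines p r && refines q r.
Proof.
apply/refinesP/andP => [pqr | [/refinesP pr /refinesP qr] x y].
  by split; apply/refinesP => x y xy; apply: pqr;
     rewrite same_block_of connect1 // /linked xy ?orbT.
rewrite same_block_of => /connectP[s + ->].
elim: s x => [|z s IHs] x /=; first by rewrite same_block_refl.
case/andP=> xz /IHs zy; have /equivalence_relP[_ rt] := same_block_equiv r.
have {}xz : same_block r x z by case/orP: xz => [/pr | /qr].
by rewrite (rt _ _ xz).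
Qed.

Lemma eq_op_equiv : equivalence_rel (@eq_op T).
Proof. by apply/equivalence_relP; split=> [x | x y /eqP->]. Qed.

Definition setpart_bot : setpart T := setpart_of eq_op_equiv.

Lemma refines_bot p : refines setpart_bot p.
Proof.
by apply/refinesP => x y; rewrite same_block_of => /eqP->; apply: same_block_refl.
Qed.

End Refinement.

Fact setpart_display : Order.disp_t. Proof. exact: Order.Disp tt tt. Qed.

HB.instance Definition _ (T : finType) :=
  Order.Le_isPOrder.Build setpart_display (setpart T)
    (@refines_refl T) (@refines_anti T) (@refines_trans T).
HB.instance Definition _ (T : finType) :=
  Order.POrder_isJoinSemilattice.Build setpart_display (setpart T)
    (@refines_joinl T).
HB.instance Definition _ (T : finType) :=
  Order.hasBottom.Build setpart_display (setpart T) (@refines_bot T).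

Definition is_intpart (k : nat) (s : seq nat) : bool :=
  [&& sorted geq s, 0 \notin s & sumn s == k].

Definition setpart_type (T : finType) (p : setpart T) : seq nat :=
  sort geq [seq #|B| | B : {set T} in blocks p].

Definition join_le (k : nat) (mu la : seq nat) : Prop :=
  exists (l : nat) (p : 'I_l.+1 -> setpart 'I_k),
    (forall i, setpart_type (p i) = la) /\
    setpart_type (\join_(i < l.+1) p i)%O = mu.

Definition coarser (mu la : seq nat) : Prop :=
  exists I : setpart 'I_(size la),
    mu = sort geq
      [seq \sum_(i in B) nth 0 la i | B : {set 'I_(size la)} in blocks I].

(* Returns 0 when all parts equal 1. *)
Definition min_non1_part (nu : seq nat) : nat :=
  head 0 (sort leq [seq i <- nu | i != 1]).

(* Main.v *)
Require Import Defs.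
From mathcomp Require Import all_boot all_order.
From mathcomp Require Import perm.

Import Order.TTheory.

Set Implicit Arguments.
Unset Strict Implicit.
Unset Printing Implicit Defensive.

(* If [p] refines [q] and has type [la], then by symmetry any element pair inside
   a block [B] of [q] is joined by some permuted copy of [p] still refining [q],
   as soon as one copy has a nontrivial block inside [B]; when [B] only contains
   singletons of [p], exchanging a smallest nontrivial block of [p] with part of
   [B] provides such a copy, which is possible exactly when that block fits in
   [B]. So the join of all refinements of [q] of type [la] is [q]. Conversely, a
   nontrivial block of a join contains a nontrivial block of some joinand. *)

(** * Blocks and joins of set partitions *)

Section SetPartitions.
Variable T : finType.
Implicit Types (p q : setpart T) (x y z : T) (B C : {set T}).

Lemma same_block_sym p x y : same_block p x y = same_block p y x.
Proof.
have /equivalence_relP[r rt] := same_block_equiv p.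
by apply/idP/idP => h; rewrite -(rt _ _ h) r.
Qed.

Lemma same_block_trans p y x z :
  same_block p x y -> same_block p y z -> same_block p x z.
Proof. by have /equivalence_relP[_ rt] := same_block_equiv p => /rt ->. Qed.

Lemma setpart_leP p q :
  reflect (forall x y, same_block p x y -> same_block q x y) (p <= q)%O.
Proof. exact: refinesP. Qed.

Lemma blocks_same_block p B x y :
  B \in blocks p -> x \in B -> same_block p x y = (y \in B).
Proof. by move=> pB xB; rewrite /same_block (def_pblock (setpart_tiP p) pB xB). Qed.

Lemma block_same_block p x : [set y | same_block p x y] \in blocks p.
Proof.
have -> : [set y | same_block p x y] = pblock (blocks p) x.
  by apply/setP => y; rewrite inE.
by rewrite pblock_mem ?setpart_cover.
Qed.

Lemma block_inhabited p B : B \in blocks p -> exists x, x \in B.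
Proof. by move=> pB; apply/set0Pn; apply: (partition_neq0 (blocksP p) pB). Qed.

Lemma setpart_typeP p n :
  reflect (exists2 B, B \in blocks p & n = #|B|) (n \in setpart_type p).
Proof. by rewrite mem_sort; apply: imageP. Qed.

Lemma same_block_bot x y : same_block (setpart_bot T) x y = (x == y).
Proof. exact: same_block_of. Qed.

(* Comparing all [p i] with the partition [{x}, ~: {x}] shows that [x] cannot
   be a singleton of every [p i]. *)
Lemma same_block_joins (I : finType) (p : I -> setpart T) x y :
  same_block (\join_i p i)%O x y -> x != y ->
  exists i, exists2 z, z != x & same_block (p i) x z.
Proof.
move=> xy nxy.
have e_equiv : equivalence_rel (fun u v : T => (u == x) == (v == x)).
  by apply/equivalence_relP; split=> // u v /eqP uv w; rewrite uv.
have [/existsP[i /existsP[z /andP[zx xz]]]|nz] :=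
  boolP [exists i, exists z, (z != x) && same_block (p i) x z].
  by exists i, z.
have le : (\join_i p i <= setpart_of e_equiv)%O.
  apply/joinsP => i _; apply/setpart_leP => u v uv; rewrite same_block_of.
  have single w : same_block (p i) x w -> w = x.
    move=> xw; apply/eqP; apply: contraNT nz => wx.
    by apply/existsP; exists i; apply/existsP; exists w; rewrite wx.
  apply/eqP; apply/eqP/eqP => e; move: uv; rewrite e.
    exact: single.
  by rewrite same_block_sym; apply: single.
have := setpart_leP _ _ le _ _ xy.
by rewrite same_block_of eqxx eq_sym eqb_id eq_sym (negPf nxy).
Qed.

End SetPartitions.

(** Types are sorted lists, so comparing two types reduces to comparing multisets of block sizes. *)
Lemma perm_sort_geqP (s t : seq nat) :
  reflect (sort geq s = sort geq t) (perm_eq s t).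
Proof.
apply: perm_sortP => [m n|a b c ba ac|a b /andP[ba ab]].
- exact: leq_total.
- exact: leq_trans ac ba.
- by apply/eqP; rewrite eqn_leq; apply/andP.
Qed.

(** * Pullback of set partitions along a map *)

Section Preimage.
Variables (T U : finType) (f : T -> U).

Lemma preim_equiv (q : setpart U) :
  equivalence_rel (fun x y => same_block q (f x) (f y)).
Proof.
apply/equivalence_relP; split=> [x|x y xy z]; first exact: same_block_refl.
have /equivalence_relP[_ rt] := same_block_equiv q.
exact: rt.
Qed.

(** Serves two purposes: permutations relabel points without changing the type, and labellings of
    points by part indices carry partitions of the index set back to the points. *)
Definition setpart_preim (q : setpart U) : setpart T :=
  setpart_of (preim_equiv q).

Lemma same_block_preim q x y :
  same_block (setpart_preim q) x y = same_block q (f x) (f y).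
Proof. exact: same_block_of. Qed.

Hypothesis f_surj : forall u, exists x, f x = u.

(** Surjectivity keeps every [f @^-1: B] nonempty, hence a genuine block. *)
Lemma blocks_preim q :
  blocks (setpart_preim q) = [set f @^-1: B | B : {set U} in blocks q].
Proof.
apply/setP => C; apply/idP/imsetP => [pC|[B qB ->]].
  have [x xC] := block_inhabited pC.
  exists [set u | same_block q (f x) u]; first exact: block_same_block.
  apply/setP => y; rewrite !inE -same_block_preim.
  by rewrite (blocks_same_block _ pC).
have [u uB] := block_inhabited qB; have [x fx] := f_surj u.
have -> : f @^-1: B = [set y | same_block (setpart_preim q) x y].
  apply/setP => y; rewrite !inE same_block_preim.
  by rewrite (blocks_same_block _ qB) // fx.
exact: block_same_block.
Qed.

(** A pulled-back block is a disjoint union of fibres, and surjectivity keeps distinct blocks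
    distinct. When the fibre sizes are the parts of [la], the right-hand side is the formula in
    [coarser]. *)
Lemma setpart_type_preim q :
  setpart_type (setpart_preim q) =
  sort geq [seq \sum_(i in B) #|f @^-1: [set i]| | B : {set U} in blocks q].
Proof.
apply/perm_sort_geqP.
have preim_inj : injective (fun B : {set U} => f @^-1: B).
  move=> B C /setP e; apply/setP => u; have [x <-] := f_surj u.
  by have := e x; rewrite !inE.
have card_preim (B : {set U}) : \sum_(i in B) #|f @^-1: [set i]| = #|f @^-1: B|.
  rewrite -[RHS]sum1_card (partition_big f (mem B)) /=; last first.
    by move=> x; rewrite inE.
  apply: eq_bigr => i iB; rewrite -sum1_card; apply: eq_bigl => x.
  by rewrite !inE; case: eqP => [->|_]; rewrite ?iB ?andbF.
rewrite blocks_preim /image_mem (eq_map card_preim).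
rewrite (map_comp (fun A : {set T} => #|A|) (fun B : {set U} => f @^-1: B)).
apply: perm_map; apply: uniq_perm.
- exact: enum_uniq.
- by rewrite map_inj_uniq ?enum_uniq.
move=> C; rewrite mem_enum; apply/imsetP/mapP => -[B qB ->]; exists B => //.
  by rewrite mem_enum.
by rewrite mem_enum in qB.
Qed.

End Preimage.

Lemma setpart_type_preim_inj (T : finType) (s : T -> T) (p : setpart T) :
  injective s -> setpart_type (setpart_preim s p) = setpart_type p.
Proof.
move=> s_inj; have [t ts st] := injF_bij s_inj.
rewrite setpart_type_preim; last by move=> u; exists (t u).
congr sort; apply: eq_map => B; rewrite -sum1_card; apply: eq_bigr => i _.
rewrite -[RHS](cards1 (t i)); apply: eq_card => x; rewrite !inE.
by apply/eqP/eqP => [<-|->].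
Qed.

(** * The involution swapping two disjoint lists *)

Section ExchangeLists.
Variables (T : eqType) (c d : seq T).
Hypotheses (uc : uniq c) (ud : uniq d) (scd : size c = size d).
Hypothesis dis : forall x, x \in c -> x \notin d.

Definition exchange (z : T) : T :=
  if z \in c then nth z d (index z c)
  else if z \in d then nth z c (index z d) else z.

Lemma exchange_l z : z \in c -> exchange z \in d.
Proof. by move=> zc; rewrite /exchange zc mem_nth // -scd index_mem. Qed.

Lemma exchange_r z : z \in d -> exchange z \in c.
Proof.
move=> zd; rewrite /exchange ifN; last by apply/negP => /dis; rewrite zd.
by rewrite zd mem_nth // scd index_mem.
Qed.

Lemma exchangeK : involutive exchange.
Proof.
move=> z; have [zc|zNc] := boolP (z \in c).
  have := exchange_l zc => ed; rewrite {1}/exchange ed.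
  rewrite ifN; last by apply/negP => /dis; rewrite ed.
  have zi : index z c < size c by rewrite index_mem.
  (* The outer [nth] has [exchange z] as default; it is replaced by [z] so that [nth_index]
     applies. *)
  rewrite /exchange zc index_uniq -?scd // (set_nth_default z) ?nth_index //.
have [zd|zNd] := boolP (z \in d).
  have := exchange_r zd => ec; rewrite {1}/exchange ec.
  have zi : index z d < size d by rewrite index_mem.
  rewrite /exchange (negPf zNc) zd index_uniq ?scd //.
  by rewrite (set_nth_default z) ?nth_index.
have e : exchange z = z by rewrite /exchange (negPf zNc) (negPf zNd).
by rewrite !e.
Qed.

End ExchangeLists.

(** * Refinements of fixed type linking a given pair *)

Section SameTypeRefinements.
Variable T : finType.
Implicit Types (p q : setpart T) (x y u v : T).

Lemma same_block_tperm q x y z :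
  same_block q x y -> same_block q (tperm x y z) z.
Proof.
move=> xy; case: tpermP => [->|->|_ _]; rewrite ?same_block_refl //.
by rewrite same_block_sym.
Qed.

(** Two transpositions carry [x] to [u] and [y] to [v]. Each swaps points of a single block of [q],
    so pulling [p] back along their composite stays below [q]. *)
Lemma move_pair p q x y u v :
  (p <= q)%O -> x != y -> u != v -> same_block q x y -> same_block q x u ->
  same_block p u v ->
  exists p', [/\ setpart_type p' = setpart_type p, (p' <= q)%O
               & same_block p' x y].
Proof.
move=> /setpart_leP pq xy uv qxy qxu puv.
(* [w] is where the first transposition sends [y]; the second moves it to [v] and fixes [u], as [w]
   and [v] differ from [u]. *)
pose w := tperm x u y; pose s z := tperm w v (tperm x u z).
have s_inj : injective s by apply: inj_comp; apply: perm_inj.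
have qwv : same_block q w v.
  apply: same_block_trans (same_block_tperm y qxu) _.
  rewrite same_block_sym in qxy; apply: same_block_trans qxy _.
  exact: same_block_trans qxu (pq _ _ puv).
have sq z : same_block q (s z) z.
  apply: same_block_trans (same_block_tperm _ qwv) _.
  exact: same_block_tperm.
have sx : s x = u.
  have wu : w != u by rewrite /w -{2}(tpermL x u) (inj_eq perm_inj) eq_sym.
  by rewrite /s tpermL tpermD // eq_sym.
have sy : s y = v by rewrite /s tpermL.
exists (setpart_preim s p); split.
- exact: setpart_type_preim_inj.
- apply/setpart_leP => z z'; rewrite same_block_preim => /pq h.
  apply: same_block_trans (same_block_trans h (sq z')).
  by rewrite same_block_sym.
- by rewrite same_block_preim sx sy.
Qed.

(* If [p] has only singletons inside the [q]-block of [x], exchange the block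
   [C] with part of that [q]-block. *)
Lemma join_reaches_pair p q x y C :
  (p <= q)%O -> C \in blocks p -> 1 < #|C| ->
  #|C| <= #|[set z | same_block q x z]| -> x != y -> same_block q x y ->
  exists p', [/\ setpart_type p' = setpart_type p, (p' <= q)%O
               & same_block p' x y].
Proof.
move=> pq pC C1 leC xy qxy.
have [/existsP[u /existsP[v /and3P[uv qxu puv]]]|nz] :=
  boolP [exists u, exists v, [&& u != v, same_block q x u & same_block p u v]].
  exact: move_pair puv.
have single u v : same_block q x u -> same_block p u v -> u = v.
  move=> qxu puv; apply/eqP; apply: contraNT nz => uv.
  by apply/existsP; exists u; apply/existsP; exists v; apply/and3P.
have [d [ud sd dsub]] := card_geqP leC.
have dq z : z \in d -> same_block q x z by move/dsub; rewrite inE.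
pose c := enum C; pose s := exchange c d.
have uc : uniq c := enum_uniq _.
have scd : size c = size d by rewrite sd -cardE.
(* A common point would be a singleton of [p], but [C] has at least two points. *)
have dis z : z \in c -> z \notin d.
  rewrite mem_enum => zC; apply/negP => /dq qxz.
  have [a [b [aC bC ab]]] := card_gt1P C1.
  have za : z = a by apply: single => //; rewrite (blocks_same_block _ pC).
  have zb : z = b by apply: single => //; rewrite (blocks_same_block _ pC).
  by rewrite -za -zb eqxx in ab.
have sK : involutive s := exchangeK uc ud scd dis.
have s_inj : injective s := inv_inj sK.
(* If [s z] is in [c], both [z] and [z'] lie in [d], within one block of [q]. If one image is in
   [d], it is a singleton of [p], so [z = z']. Otherwise [s] fixes both points. *)
have sp z z' : same_block p (s z) (s z') -> same_block q z z'.
  move=> pzz; have [szc|szNc] := boolP (s z \in c).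
    have sz'c : s z' \in c.
      by move: szc pzz; rewrite !mem_enum => szC; rewrite (blocks_same_block _ pC).
    have zd : z \in d by rewrite -(sK z) exchange_l.
    have z'd : z' \in d by rewrite -(sK z') exchange_l.
    by apply: same_block_trans (dq _ z'd); rewrite same_block_sym dq.
  have [szd|szNd] := boolP (s z \in d).
    by have /s_inj -> := single _ _ (dq _ szd) pzz; apply: same_block_refl.
  have fixs w : s w \notin c -> s w \notin d -> s w = w.
    by move=> wc wd; rewrite -[RHS]sK /s [RHS]/exchange (negPf wc) (negPf wd).
  have [sz'c|sz'Nc] := boolP (s z' \in c).
    rewrite !mem_enum in sz'c szNc.
    by move: pzz; rewrite same_block_sym (blocks_same_block _ pC) // (negPf szNc).
  have [sz'd|sz'Nd] := boolP (s z' \in d).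
    rewrite same_block_sym in pzz.
    by have /s_inj -> := single _ _ (dq _ sz'd) pzz; apply: same_block_refl.
  have [sz sz'] := (fixs z szNc szNd, fixs z' sz'Nc sz'Nd).
  by apply: (setpart_leP _ _ pq); rewrite sz sz' in pzz.
(* [s] sends [d] into [C], so the pullback of [p] links two distinct points of [d], and [move_pair]
   applies to it. *)
have [u [v [ud' vd' uv]]] : exists u v, [/\ u \in d, v \in d & u != v].
  by apply/card_gt1P; rewrite (card_uniqP ud) sd.
rewrite -(setpart_type_preim_inj p s_inj).
apply: (move_pair _ xy uv qxy (dq _ ud')).
  by apply/setpart_leP => z z'; rewrite same_block_preim; apply: sp.
have suC : s u \in C by rewrite -mem_enum exchange_r.
by rewrite same_block_preim (blocks_same_block _ pC) // -mem_enum exchange_r.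
Qed.

End SameTypeRefinements.

(** * Integer partitions and coarsening realised by set partitions *)

Section IntegerPartitions.
Variable k : nat.
Implicit Types (nu la mu : seq nat).

Lemma intpart_part_gt0 nu n : is_intpart k nu -> n \in nu -> 0 < n.
Proof. by case/and3P => _ n0 _; rewrite lt0n; apply: contraTneq => ->. Qed.

Lemma min_non1_part_mem nu :
  is_intpart k nu -> nu <> nseq k 1 ->
  (min_non1_part nu \in nu) && (1 < min_non1_part nu).
Proof.
move=> nuP nu1; set s := [seq i <- nu | i != 1].
have : min_non1_part nu \in s.
  rewrite /min_non1_part -/s -(mem_sort leq).
  case E: (sort leq s) => [|a r]; last by rewrite mem_head.
  (* Here [head] returned its default 0: all parts are 1, and the sum [k] fixes their number. *)
  case: nu1; have s0 : s = [::] by apply/nilP; rewrite /nilp -(size_sort leq) E.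
  have /all_pred1P nuE : all (pred1 1) nu.
    apply/allP => n nnu /=; apply: contraT => n1.
    have : n \in s by rewrite mem_filter n1.
    by rewrite s0.
  by have /and3P[_ _ /eqP] := nuP; rewrite nuE sumn_nseq mul1n => <-.
rewrite mem_filter => /andP[m1 mnu]; rewrite mnu ltn_neqAle eq_sym m1.
exact: intpart_part_gt0 mnu.
Qed.

Lemma min_non1_part_le nu n :
  is_intpart k nu -> n \in nu -> 1 < n -> min_non1_part nu <= n.
Proof.
move=> nuP nnu n1; rewrite /min_non1_part.
have : n \in sort leq [seq i <- nu | i != 1].
  by rewrite mem_sort mem_filter nnu neq_ltn n1 orbT.
have := sort_sorted leq_total [seq i <- nu | i != 1].
case: sort => //= a r; rewrite (path_sortedE leq_trans) => /andP[/allP ar _].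
by rewrite inE => /predU1P[->|/ar].
Qed.

Lemma intpart_labelling la :
  is_intpart k la ->
  exists f : 'I_k -> 'I_(size la),
    forall i, #|f @^-1: [set i]| = nth 0 la i.
Proof.
case/and3P => _ _ /eqP sumla.
(* The disjoint union of one set per part has [sumn la = k] elements; the labelling is its first
   projection. *)
pose W := {i : 'I_(size la) & 'I_(nth 0 la i)}.
have cardW : k = #|{: W}|.
  rewrite card_tagged -sumla -[la in LHS](mkseq_nth 0) /mkseq -val_enum_ord.
  rewrite -map_comp.
  by congr sumn; apply: eq_map => i /=; rewrite card_ord.
pose g (x : 'I_k) : W := enum_val (cast_ord cardW x).
have g_inj : injective g by move=> x y /enum_val_inj /cast_ord_inj.
have g_surj w : exists x, g x = w.
  by exists (cast_ord (esym cardW) (enum_rank w)); rewrite /g cast_ordKV enum_rankK.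
exists (fun x => tag (g x)) => i.
rewrite -[RHS]card_ord.
pose W_ (j : 'I_(size la)) := 'I_(nth 0 la j).
rewrite (bij_eq_card (tag_with_bij W_ i)) card_sub.
rewrite -(card_imset _ g_inj).
apply: eq_card => w; apply/imsetP/idP => [[x] + ->|wi].
  by rewrite !inE.
by have [x gx] := g_surj w; exists x; rewrite ?inE gx.
Qed.

(* [f] sends a point to the index of its block in a list of the blocks sorted by
   decreasing size. *)
Lemma setpart_labelling (T : finType) (p : setpart T) :
  exists f : T -> 'I_(size (setpart_type p)),
    [/\ forall x y, (f x == f y) = same_block p x y,
        forall i, exists x, f x = i
      & forall i, #|f @^-1: [set i]| = nth 0 (setpart_type p) i].
Proof.
pose bs := sort (relpre (fun B : {set T} => #|B|) geq) (enum (blocks p)).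
have typeE : setpart_type p = [seq #|B| | B : {set T} <- bs].
  by rewrite /setpart_type /image_mem sort_map.
have mem_bs B : (B \in bs) = (B \in blocks p) by rewrite mem_sort mem_enum.
have bs_uniq : uniq bs by rewrite sort_uniq enum_uniq.
have size_bs : size bs = size (setpart_type p) by rewrite typeE size_map.
have blk x : pblock (blocks p) x \in bs.
  by rewrite mem_bs pblock_mem ?setpart_cover.
have lt x : index (pblock (blocks p) x) bs < size (setpart_type p).
  by rewrite -size_bs index_mem.
pose f x := Ordinal (lt x).
have fE x (i : 'I_(size (setpart_type p))) : (f x == i) = (x \in nth set0 bs i).
  have i_lt : i < size bs by rewrite size_bs.
  have Bp : nth set0 bs i \in blocks p by rewrite -mem_bs mem_nth.
  rewrite -val_eqE /= -{1}(index_uniq set0 i_lt bs_uniq).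
  apply/eqP/idP => [e|xB].
    rewrite -(nth_index set0 (mem_nth set0 i_lt)) -e nth_index //.
    by rewrite mem_pblock setpart_cover.
  by rewrite (def_pblock (setpart_tiP p) Bp xB).
exists f; split=> [x y|i|i].
- by rewrite eq_sym fE /= nth_index.
- have Bp : nth set0 bs i \in blocks p by rewrite -mem_bs mem_nth ?size_bs.
  have [x xB] := block_inhabited Bp.
  by exists x; apply/eqP; rewrite fE.
have -> : nth 0 (setpart_type p) i = #|nth set0 bs i|.
  by rewrite {1}typeE (nth_map set0) ?size_bs.
by apply: eq_card => x; rewrite !inE fE.
Qed.

Lemma coarser_setpart mu la :
  is_intpart k la ->
  coarser mu la <->
  exists p q : setpart 'I_k,
    [/\ (p <= q)%O, setpart_type p = la & setpart_type q = mu].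
Proof.
move=> laP; split=> [[I ->]|[p [q [pq pla qmu]]]].
  have [f fibre] := intpart_labelling laP.
  have f_surj i : exists x, f x = i.
    have : 0 < #|f @^-1: [set i]|.
      by rewrite fibre; apply: intpart_part_gt0 laP _; rewrite mem_nth.
    by case/card_gt0P => x; rewrite !inE => /eqP; exists x.
  (* [p] consists of the fibres of [f]; [q] merges them as [I] groups the parts. *)
  exists (setpart_preim f (setpart_bot _)), (setpart_preim f I); split.
  - apply/setpart_leP => x y; rewrite !same_block_preim same_block_bot.
    by move/eqP->; apply: same_block_refl.
  - rewrite setpart_type_preim //.
    have /and3P[la_sorted _ _] := laP.
    rewrite -[RHS](sorted_sort _ la_sorted); last first.
      by move=> a b c ba ac; apply: leq_trans ac ba.
    apply/perm_sort_geqP.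
    have botE : perm_eq (enum (blocks (setpart_bot 'I_(size la))))
                  [seq [set i] | i <- enum 'I_(size la)].
      apply: uniq_perm; first exact: enum_uniq.
        by rewrite map_inj_uniq ?enum_uniq //; apply: set1_inj.
      have single i : [set i] = [set j | same_block (setpart_bot _) i j].
        by apply/setP => j; rewrite !inE same_block_bot eq_sym.
      move=> B; rewrite mem_enum; apply/idP/mapP => [bB|[i _ ->]].
        have [i iB] := block_inhabited bB; exists i; first by rewrite mem_enum.
        by rewrite single; apply/setP => j; rewrite inE (blocks_same_block _ bB).
      by rewrite single; apply: block_same_block.
    apply: perm_trans (perm_map _ botE) _; rewrite -map_comp.
    rewrite -[la in X in perm_eq _ X](mkseq_nth 0) /mkseq -val_enum_ord.
    rewrite -map_comp.
    rewrite (@eq_map _ _ _ (nth 0 la \o val)) // => i /=.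
    by rewrite big_set1.
  rewrite setpart_type_preim //; congr sort.
  by apply: eq_map => B; apply: eq_bigr => i _.
subst la mu; have [f [f_eq f_surj fibre]] := setpart_labelling p.
(* [g] picks a point in each block of [p], and indices are grouped as [q] groups these points. Since
   [g (f z)] lies in the [p]-block of [z], pulling back along [f] recovers [q]. *)
have [g fg] := fin_all_exists f_surj.
exists (setpart_preim g q).
transitivity (setpart_type (setpart_preim f (setpart_preim g q))); last first.
  rewrite setpart_type_preim //; congr sort.
  by apply: eq_map => B; apply: eq_bigr => i _.
congr setpart_type.
apply: same_block_inj => x y; rewrite !same_block_preim.
have gf z : same_block q z (g (f z)).
  by apply: (setpart_leP _ _ pq); rewrite -f_eq fg.
apply/idP/idP => h.
  apply: same_block_trans (gf y); rewrite same_block_sym.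
  by apply: same_block_trans (gf x); rewrite same_block_sym.
apply: same_block_trans (gf x) _; apply: same_block_trans h _.
by rewrite same_block_sym.
Qed.

End IntegerPartitions.

(** * Joins of partitions of one type versus coarsening *)

Theorem theorem3p4 (k : nat) (mu la : seq nat) (hk : 0 < k)
    (hmu : is_intpart k mu) (hla : is_intpart k la)
    (hmu1 : mu <> nseq k 1) (hla1 : la <> nseq k 1) :
  join_le k mu la <-> (coarser mu la /\ min_non1_part la <= min_non1_part mu).
Proof.
have /andP[la_m la_gt1] := min_non1_part_mem hla hla1.
have /andP[mu_m mu_gt1] := min_non1_part_mem hmu hmu1.
split=> [[l [p [pla jmu]]]|[/(coarser_setpart _ hla)[p [q [pq pla qmu]]] le]].
  split.
    apply/(coarser_setpart _ hla); exists (p ord0), (\join_(i < l.+1) p i)%O.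
    by split=> //; apply: joins_sup.
  have : min_non1_part mu \in setpart_type (\join_(i < l.+1) p i)%O by rewrite jmu.
  case/setpart_typeP => B jB BE; rewrite BE.
  have : 1 < #|B| by rewrite -BE.
  case/card_gt1P => x [y [xB yB xy]].
  have [] := @same_block_joins _ _ p x y; rewrite ?(blocks_same_block _ jB) //.
  move=> i [z zx xz]; set C := [set w | same_block (p i) x w].
  have sCB : C \subset B.
    apply/subsetP => w; rewrite inE -(blocks_same_block w jB xB).
    by apply: setpart_leP; apply: joins_sup.
  apply: leq_trans (subset_leq_card sCB); apply: min_non1_part_le hla _ _.
    rewrite -(pla i); apply/setpart_typeP; exists C => //.
    exact: block_same_block.
  by apply/card_gt1P; exists x, z; rewrite !inE same_block_refl eq_sym.
have [C pC CE] : exists2 C, C \in blocks p & min_non1_part la = #|C|.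
  by apply/setpart_typeP; rewrite pla.
pose A := [set p' : setpart 'I_k | (setpart_type p' == la) && (p' <= q)%O].
(* This family has [#|A|.+1] members; the last index falls on the default [p], which also lies in
   [A]. *)
exists #|A|, (fun i => nth p (enum A) i).
have nthA i : nth p (enum A) i \in A.
  have [ltA|geA] := ltnP i (size (enum A)); first by rewrite -mem_enum mem_nth.
  by rewrite nth_default // inE pla eqxx.
split=> [i|]; first by have := nthA i; rewrite inE => /andP[/eqP].
rewrite -qmu; congr setpart_type; apply/le_anti/andP; split.
  by apply/joinsP => i _; have := nthA i; rewrite inE => /andP[].
apply/setpart_leP => x y qxy.
have [->|xy] := eqVneq x y; first exact: same_block_refl.
(* The block contains both [x] and [y], so its size is a part of [mu] above 1. *)
have block_ge : #|C| <= #|[set z | same_block q x z]|.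
  rewrite -CE; apply: leq_trans le _; apply: min_non1_part_le hmu _ _.
    rewrite -qmu; apply/setpart_typeP; exists [set z | same_block q x z] => //.
    exact: block_same_block.
  by apply/card_gt1P; exists x, y; rewrite !inE same_block_refl.
rewrite CE in la_gt1.
have [p' [p'la p'q p'xy]] := join_reaches_pair pq pC la_gt1 block_ge xy qxy.
have p'A : p' \in enum A by rewrite mem_enum inE p'la pla eqxx.
have ltA : index p' (enum A) < #|A|.+1.
  by rewrite ltnS cardE ltnW // index_mem.
have : (nth p (enum A) (Ordinal ltA) <= \join_(i < #|A|.+1) nth p (enum A) i)%O.
  exact: joins_sup.
by rewrite /= nth_index // => /setpart_leP; apply.
Qed.
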